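(* Let $p$ be a prime and $n$ a positive integer, with $n$ sufficiently large and $n^{6}\le p\le n^{C}$ for a fixed constant $C$. For every $n$-element set $X\subset[p]$, the expected maxload of $\mathsf{2LH}$ on $X$ is at most $n/2+\widetilde{\mathcal{O}}(\sqrt{n})$ (i.e. $n/2+\sqrt{n}\,(\log n)^{\mathcal{O}(1)}$).
   Context: $[N]=\{0,\dots,N-1\}$; $\mathfrak{m}_p(x)$ is the unique element of $(x+p\mathbb{Z})\cap[0,p)$. Multiplicative two-bin linear hashing $\mathsf{2LH}$: choose $a$ uniformly from $\{1,\dots,p-1\}$ and place $x\in[p]$ in bin $\lfloor \mathfrak{m}_p(ax)/(p/2)\rfloor\in\{0,1\}$. The maxload on $X$ is the number of elements of $X$ in the fuller of the two bins. *)

(* Defs.v *)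
From HB Require Import structures.
From mathcomp Require Import all_boot all_order all_algebra.
From mathcomp Require Import reals exp.

Set Implicit Arguments.
Unset Strict Implicit.
Unset Printing Implicit Defensive.

Import Order.TTheory GRing.Theory Num.Theory.
Local Open Scope ring_scope.

(* The bin floor(m_p(a x) / (p / 2)), where m_p(a x) = (a * x) %% p. *)
Definition bin2LH (p a x : nat) : int :=
  Num.floor (((a * x) %% p)%N%:R / (p%:R / 2) : rat).

Definition load2LH (p : nat) (X : {set 'I_p}) (a : nat) (b : int) : nat :=
  #|[set x in X | bin2LH p a x == b]|.

Definition maxload2LH (p : nat) (X : {set 'I_p}) (a : nat) : nat :=
  maxn (load2LH X a 0) (load2LH X a 1).

Definition expected_maxload2LH (R : realType) (p : nat) (X : {set 'I_p}) : R :=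
  (\sum_(1 <= a < p) (maxload2LH X a)%:R) / (p.-1)%:R.

(* Main.v *)
(** Writing [s] for the sign that is [1] on the first bin and [-1] on the
    second, the maxload is [(n + |S a|) / 2] with
    [S a = \sum_(x in X) s (a x)].  Expand [s] in additive characters of
    [Z/p]: since [a] multiplies the argument, the character of frequency
    [k != 0] contributes to [S] a function of [a] whose mean square is exactly
    [n], by Parseval, whatever [X] is.  Hence the root mean square of [S] is at
    most about [sqrt n] times the sum of the absolute values of the Fourier
    coefficients of [s].  These are at most [2 / k + 2 / (p - k)], so the sum
    is [O(log p)], which is [O(log n)] as [p <= n ^ C]. *)
Require Import Defs.
From HB Require Import structures.
From mathcomp Require Import all_boot all_order all_algebra.
From mathcomp Require Import reals exp.
From mathcomp Require Import sequences trigo complex ring lra zify.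

Set Implicit Arguments.
Unset Strict Implicit.
Unset Printing Implicit Defensive.

Import Order.TTheory GRing.Theory Num.Theory.
Local Open Scope ring_scope.

(** * Weighted Cauchy-Schwarz and square waves *)

(** This is the nonnegativity of a variance: the gap between the two sides, times the total weight
    [W], is [\sum_i w i * (W * t i - M) ^+ 2]. A general [numFieldType] serves both the complex and
    the real sums below. *)
Lemma weighted_cauchy_schwarz (F : numFieldType) (I : finType) (w t : I -> F) :
  (forall i, 0 <= w i) -> (forall i, 0 <= t i) ->
  (\sum_i w i * t i) ^+ 2 <= (\sum_i w i) * \sum_i w i * t i ^+ 2.
Proof.
move=> w0 t0; set M := \sum_i w i * t i; set Q := \sum_i w i * t i ^+ 2.
set W := \sum_i w i; have W0 : 0 <= W by apply: sumr_ge0.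
have [W_eq0|Wn0] := eqVneq W 0.
  have wz i : w i = 0 by apply: (psumr_eq0P _ W_eq0).
  by rewrite W_eq0 mul0r /M big1 ?expr0n// => i _; rewrite wz mul0r.
have Mreal : M \is Num.real.
  by apply: sum_real => i _; rewrite realM// ger0_real.
have Wgt0 : 0 < W by rewrite lt_def Wn0.
rewrite -subr_ge0 -(pmulr_rge0 _ Wgt0).
suff -> : W * (W * Q - M ^+ 2) = \sum_i w i * (W * t i - M) ^+ 2.
  apply: sumr_ge0 => i _; rewrite mulr_ge0// real_exprn_even_ge0// realB//.
  by rewrite realM// ger0_real.
have -> : \sum_i w i * (W * t i - M) ^+ 2 =
    \sum_i (W ^+ 2 * (w i * t i ^+ 2) - W * M *+ 2 * (w i * t i) +
             M ^+ 2 * w i).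
  by apply: eq_bigr => i _; ring.
by rewrite big_split sumrB/= -!mulr_sumr -/W -/M -/Q; ring.
Qed.

(** The ring is a parameter so that the same sign can be read in the reals and in the complex
    numbers. *)
Definition square_wave (R : pzRingType) (h j : nat) : R :=
  if (j < h)%N then 1 else -1.

Lemma sum_square_wave (R : pzRingType) (h p : nat) (f : nat -> R) :
  (h <= p)%N ->
  \sum_(j < p) square_wave R h j * f j =
  \sum_(0 <= j < h) f j - \sum_(h <= j < p) f j.
Proof.
move=> hp; rewrite -(big_mkord predT (fun j => square_wave R h j * f j)).
rewrite (big_cat_nat _ hp)//= -sumrN !big_nat; congr (_ + _).
  by apply: eq_bigr => j /andP[_ jh]; rewrite /square_wave jh mul1r.
by apply: eq_bigr => j /andP[jh _]; rewrite /square_wave ltnNge jh /= mulN1r.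
Qed.

(** * Fourier analysis on Z/p *)

Section FiniteFourier.
Variables (F : numClosedFieldType) (p : nat) (w : F).
Hypothesis w_prim : p.-primitive_root w.

Let p_gt0 : (0 < p)%N := prim_order_gt0 w_prim.
Let p_neq0 : p%:R != 0 :> F.
Proof. by rewrite pnatr_eq0 -lt0n. Qed.

Lemma sum_expr_eq0 (z : F) : z ^+ p = 1 -> z != 1 -> \sum_(i < p) z ^+ i = 0.
Proof.
move=> zp z1; apply/eqP; have /eqP := subrX1 z p.
by rewrite zp subrr eq_sym mulf_eq0 subr_eq0 (negPf z1).
Qed.

Lemma prim_root_neq0 : w != 0.
Proof. by rewrite (prim_root_eq0 w_prim) -lt0n. Qed.

Lemma norm_prim_root : `|w| = 1.
Proof.
apply/eqP; rewrite -(pexpr_eq1 p_gt0)// -normrX.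
by rewrite (prim_expr_order w_prim) normr1.
Qed.

Lemma conj_prim_root : w^* = w^-1.
Proof. by rewrite invC_norm norm_prim_root expr1n invr1 mul1r. Qed.

(** The ratio is a [p]-th root of unity, so its geometric series vanishes unless the ratio is 1. *)
Lemma character_orthogonality (i j : nat) :
  \sum_(k < p) (w ^+ i / w ^+ j) ^+ k = p%:R *+ (i == j %[mod p]).
Proof.
have wj0 : w ^+ j != 0 by rewrite expf_neq0// prim_root_neq0.
rewrite -(eq_prim_root_expr w_prim).
case: eqVneq => [->|wij]; rewrite ?mulr1n ?mulr0n.
  rewrite divff// (eq_bigr (fun=> 1)) => [|k _]; last by rewrite expr1n.
  by rewrite sumr_const card_ord.
apply: sum_expr_eq0; last first.
  by apply: contraNneq wij => e; rewrite -(divfK wj0 (w ^+ i)) e mul1r.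
by rewrite expr_div_n -!exprM ![(_ * p)%N]mulnC !exprM (prim_expr_order w_prim)
  !expr1n divr1.
Qed.

Definition fourier_coef (f : nat -> F) (k : nat) : F :=
  p%:R^-1 * \sum_(j < p) f j * w ^+ (j * k).

(** The Wiener algebra norm; it is the total weight when Cauchy-Schwarz is applied over
    frequencies. *)
Definition wiener_norm (f : nat -> F) : F :=
  \sum_(k < p) `|fourier_coef f k|.

Lemma fourier_inversion (f : nat -> F) (m : nat) : (m < p)%N ->
  f m = \sum_(k < p) fourier_coef f k * w ^- (m * k).
Proof.
move=> mp; rewrite /fourier_coef.
under eq_bigr do rewrite -mulrA mulr_suml.
rewrite -mulr_sumr exchange_big/=.
have E (j : 'I_p) : \sum_(k < p) f j * w ^+ (j * k) * w ^- (m * k) =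
    f j * (p%:R *+ (j == Ordinal mp)).
  have -> : (j == Ordinal mp) = (j == m %[mod p]) by rewrite !modn_small.
  rewrite -character_orthogonality mulr_sumr; apply: eq_bigr => k _.
  by rewrite -mulrA expr_div_n -!exprM.
rewrite (eq_bigr _ (fun j _ => E j)) (bigD1 (Ordinal mp))//= eqxx big1 => [|j].
  by rewrite addr0 mulr1n mulrCA mulVf// mulr1.
by move/negPf->; rewrite mulr0n mulr0.
Qed.

(** What frequency [k] contributes at the multiplier [a], up to its Fourier coefficient. *)
Definition dilate_char_sum (X : {set 'I_p}) (k a : nat) : F :=
  \sum_(x in X) w ^- (k * a * x).

Lemma dilate_char_sum0 (X : {set 'I_p}) (a : nat) :
  dilate_char_sum X 0 a = #|X|%:R.
Proof.
rewrite /dilate_char_sum (eq_bigr (fun=> 1)) ?sumr_const// => x _.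
by rewrite !mul0n expr0 invr1.
Qed.

(** Once the square is expanded, summing over [a] keeps only the pairs with [k * x = k * y] modulo
    [p]. As [k] is invertible, these are the diagonal pairs. *)
Lemma dilate_char_sum_parseval (X : {set 'I_p}) (k : nat) : coprime k p ->
  \sum_(a < p) `|dilate_char_sum X k a| ^+ 2 = p%:R * #|X|%:R.
Proof.
move=> kp.
have E (a : 'I_p) : `|dilate_char_sum X k a| ^+ 2 =
    \sum_(x in X) \sum_(y in X) (w ^+ (k * y) / w ^+ (k * x)) ^+ a.
  rewrite normCK /dilate_char_sum rmorph_sum mulr_suml.
  apply: eq_bigr => x _; rewrite mulr_sumr; apply: eq_bigr => y _.
  rewrite fmorphV rmorphXn /= conj_prim_root exprVn invrK expr_div_n mulrC.
  by rewrite -!exprM ![(k * a * _)%N]mulnAC.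
rewrite (eq_bigr _ (fun a _ => E a)) exchange_big/=.
rewrite mulr_natr -sumr_const; apply: eq_bigr => x xX.
rewrite exchange_big/= (bigD1 x)//= character_orthogonality eqxx mulr1n.
rewrite big1 ?addr0// => y /andP[_ yx]; rewrite character_orthogonality.
rewrite -(eq_prim_root_expr w_prim) !exprM.
have wk_prim : p.-primitive_root (w ^+ k).
  by rewrite (prim_root_exp_coprime _ w_prim).
by rewrite (eq_prim_root_expr wk_prim) !modn_small// val_eqE (negPf yx).
Qed.

(** Cauchy-Schwarz with the absolute Fourier coefficients as weights moves the square onto each
    frequency, where Parseval gives [p * #|X|]. Frequency 0 gives [p * #|X| ^ 2] instead, whence the
    separate term. *)
Lemma dilate_sum_second_moment (f : nat -> F) (X : {set 'I_p}) : prime p ->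
  \sum_(a < p) `|\sum_(x in X) f ((a * x) %% p)%N| ^+ 2 <=
  wiener_norm f * (p%:R * #|X|%:R *
    (`|fourier_coef f 0| * #|X|%:R + wiener_norm f)).
Proof.
move=> p_pr; set A := wiener_norm f.
have E a : \sum_(x in X) f ((a * x) %% p)%N =
    \sum_(k < p) fourier_coef f k * dilate_char_sum X k a.
  under eq_bigr => x _ do rewrite (fourier_inversion _ (ltn_pmod _ p_gt0)).
  rewrite exchange_big; apply: eq_bigr => k _; rewrite mulr_sumr.
  apply: eq_bigr => x _; congr (_ * _^-1).
  (* Since [w ^+ p = 1], the reduction modulo [p] drops out of the exponent. *)
  rewrite mulnC -(prim_expr_mod w_prim) modnMmr (prim_expr_mod w_prim).
  by rewrite mulnA.
have le1 a : `|\sum_(x in X) f ((a * x) %% p)%N| ^+ 2 <=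
    A * \sum_(k < p) `|fourier_coef f k| * `|dilate_char_sum X k a| ^+ 2.
  rewrite E; apply: le_trans (weighted_cauchy_schwarz _ _) => //.
  rewrite ler_pXn2r ?nnegrE ?sumr_ge0//; last first.
    by move=> k _; rewrite mulr_ge0.
  under [leRHS]eq_bigr do rewrite -normrM.
  exact: ler_norm_sum.
apply: (@le_trans _ _ (\sum_(a < p) (A * \sum_(k < p)
    `|fourier_coef f k| * `|dilate_char_sum X k a| ^+ 2))).
  by apply: ler_sum => a _; apply: le1.
rewrite -mulr_sumr ler_wpM2l ?sumr_ge0// exchange_big/=.
under eq_bigr do rewrite -mulr_sumr.
rewrite mulrDr /A /wiener_norm -(big_mkord predT (fun k => `|_ f k|)).
rewrite -(big_mkord predT (fun k => `|fourier_coef f k| *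
  \sum_(a < p) `|dilate_char_sum X k a| ^+ 2)).
(* Frequency 0 is split off on both sides; the share it has in [wiener_norm f] on the right is given
   away. *)
rewrite !(big_ltn p_gt0) mulrDr addrA lerD//.
  under eq_bigr do rewrite dilate_char_sum0 normr_nat.
  rewrite sumr_const card_ord -[_ *+ p]mulr_natl.
  set u := `|_|; set q := p%:R; set n := #|X|%:R.
  have -> : u * (q * n ^+ 2) = q * n * (u * n) by ring.
  by rewrite lerDl !mulr_ge0 ?normr_ge0 ?ler0n.
rewrite mulr_sumr [leLHS]big_nat_cond [leRHS]big_nat_cond.
apply: ler_sum => k; rewrite andbT => /andP[k0 kp].
rewrite dilate_char_sum_parseval 1?mulrC//.
by rewrite coprime_sym prime_coprime// gtnNdvd.
Qed.

Lemma fourier_coef_square_wave0 (h : nat) : (h <= p)%N ->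
  fourier_coef (square_wave F h) 0 = (h%:R - (p - h)%:R) / p%:R.
Proof.
move=> hp; rewrite /fourier_coef.
under eq_bigr do rewrite muln0 expr0.
rewrite (sum_square_wave (fun=> 1))// !sumr_const_nat subn0.
by rewrite mulrC.
Qed.

(** A full period of powers of [z = w ^+ k] sums to 0, so the negative part of the wave doubles the
    positive one. This leaves [2 * (1 - z ^+ h) / (1 - z)], whose numerator has modulus at most
    4. *)
Lemma fourier_coef_square_wave (h k : nat) : (h <= p)%N -> w ^+ k != 1 ->
  `|fourier_coef (square_wave F h) k| <= 4 / (p%:R * `|1 - w ^+ k|).
Proof.
move=> hp wk; set z := w ^+ k.
have z1 : 1 - z != 0 by rewrite subr_eq0 eq_sym.
have nz : `|z| = 1 by rewrite normrX norm_prim_root expr1n.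
have zp : z ^+ p = 1
  by rewrite -exprM mulnC exprM (prim_expr_order w_prim) expr1n.
rewrite /fourier_coef invfM normrM normfV normr_nat mulrCA.
rewrite ler_wpM2l ?invr_ge0 ?ler0n// ler_pdivlMr ?normr_gt0//.
under eq_bigr do rewrite mulnC exprM -/z.
rewrite (sum_square_wave (GRing.exp z))//.
have Gh : (\sum_(0 <= j < h) z ^+ j) * (1 - z) = 1 - z ^+ h.
  by rewrite big_mkord mulrC -opprB mulNr -subrX1 opprB.
have Gp : \sum_(0 <= j < h) z ^+ j + \sum_(h <= j < p) z ^+ j = 0.
  by rewrite -big_cat_nat//= big_mkord sum_expr_eq0.
have -> : \sum_(h <= j < p) z ^+ j = - \sum_(0 <= j < h) z ^+ j.
  by apply/eqP; rewrite -addr_eq0 addrC Gp.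
rewrite opprK -normrM mulrDl Gh.
apply: le_trans (ler_normD _ _) _.
have : `|1 - z ^+ h| <= 2.
  by apply: le_trans (ler_normB _ _) _; rewrite normrX nz expr1n normr1.
move=> H; apply: le_trans (lerD H H) _; rewrite -natrD//.
Qed.

End FiniteFourier.

(** * Chords between complex roots of unity *)

Section RootOfUnity.
Variables (R : realType) (p : nat).
Hypothesis p_gt0 : (0 < p)%N.
Local Open Scope complex_scope.

(** The number exp(2 pi i / p). *)
Definition unity_root : R[i] :=
  cos (pi *+ 2 / p%:R) +i* sin (pi *+ 2 / p%:R).
Local Notation w := unity_root.

Lemma expr_unity_root (m : nat) :
  w ^+ m = cos (pi *+ 2 / p%:R * m%:R) +i* sin (pi *+ 2 / p%:R * m%:R).
Proof.
elim: m => [|m IHm]; first by rewrite mulr0 cos0 sin0 expr0.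
rewrite exprSr IHm -[m.+1]addn1 natrD mulrDr mulr1 cosD sinD.
by apply/eqP; rewrite eq_complex /= !eqxx/= addrC.
Qed.

Lemma unity_root_expr_order : w ^+ p = 1.
Proof.
by rewrite expr_unity_root divfK ?pnatr_eq0 -?lt0n// cos2pi sin2pi.
Qed.

Lemma norm_unity_root : `|w| = 1.
Proof. by rewrite normc_def /= cos2Dsin2 sqrtr1. Qed.

(** The angle lies between pi/2 and pi, so its cosine is at most 0 and the real part of [1 - w ^+ m]
    is at least 1. *)
Lemma chord_second_quadrant (m : nat) : (p <= 4 * m)%N -> (2 * m <= p)%N ->
  1 <= `|1 - w ^+ m|.
Proof.
move=> pm mp; rewrite expr_unity_root normc_def /=; simpc => /=.
set t := _ * m%:R.
have p0 : 0 < p%:R :> R by rewrite ltr0n.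
have pi0 := pi_ge0 R.
have cos_t : cos t <= 0.
  rewrite -[t](subrK pi) cosDpi oppr_le0 cos_ge0_pihalf//.
  have pmR : p%:R <= 4 * m%:R :> R by rewrite -natrM ler_nat.
  have mpR : 2 * m%:R <= p%:R :> R by rewrite -natrM ler_nat.
  have te : t = pi * (2 * m%:R / p%:R) by rewrite /t -mulr_natr; ring.
  have lo : 2^-1 <= 2 * m%:R / p%:R :> R by rewrite ler_pdivlMr//; lra.
  have hi : 2 * m%:R / p%:R <= 1 :> R by rewrite ler_pdivrMr//; lra.
  by rewrite te; apply/andP; split; nra.
rewrite -[leLHS]sqrtr1 ler_wsqrtr//.
have := sqr_ge0 (sin t); nra.
Qed.

(* Some multiple of [k] lies in the second quadrant, between [p / 4] and
   [p / 2], and multiplying by [j] stretches the chord at most [j] times. *)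
Lemma chord_lower_bound_half (k : nat) : (0 < k)%N -> (2 * k <= p)%N ->
  (2 * k)%:R <= p%:R * `|1 - w ^+ k|.
Proof.
(* The largest [j] with [2 * k * j <= p]. As [j >= 1], also [p < 2 * k * (j + 1) <= 4 * k * j]. *)
move=> k0 kp; set j := (p %/ (2 * k))%N.
have k2 : (0 < 2 * k)%N by rewrite muln_gt0.
have j0 : (0 < j)%N by rewrite divn_gt0.
have jp : (j * (2 * k) <= p)%N by rewrite leq_divM.
have pj : (p < j.+1 * (2 * k))%N by rewrite ltn_ceil.
have : 1 <= `|1 - w ^+ (k * j)| by apply: chord_second_quadrant; nia.
have stretch : `|1 - w ^+ (k * j)| <= j%:R * `|1 - w ^+ k|.
  rewrite exprM -normrN opprB subrX1 normrM mulrC distrC ler_wpM2r//.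
  apply: le_trans (ler_norm_sum _ _ _) _.
  rewrite (eq_bigr (fun=> 1)) ?sumr_const ?card_ord// => i _.
  by rewrite !normrX norm_unity_root !expr1n.
move=> /le_trans /(_ stretch) le1.
rewrite -[leLHS]mulr1; apply: le_trans (ler_wpM2l (ler0n _ _) le1) _.
by rewrite mulrA -natrM ler_wpM2r// ler_nat mulnC.
Qed.

Lemma norm_chordB (k : nat) : (k <= p)%N ->
  `|1 - w ^+ (p - k)| = `|1 - w ^+ k|.
Proof.
move=> kp; have wk : `|w ^+ k| = 1 by rewrite normrX norm_unity_root expr1n.
rewrite -[LHS]mul1r -{1}wk -normrM mulrBr mulr1 -exprD subnKC//.
by rewrite unity_root_expr_order distrC.
Qed.

(** The smaller of [k] and [p - k] already suffices, by the half-range bound and the symmetry of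
    chords. Adding the other reciprocal gives one formula for all [k], ready to be summed. *)
Lemma inv_chord_le (k : nat) : (0 < k < p)%N ->
  4 / (p%:R * `|1 - w ^+ k|) <= (2 * (k%:R^-1 + (p - k)%:R^-1))%:C.
Proof.
move=> /andP[k0 kp].
have E (m : nat) : (0 < m)%N -> (2 * m)%:R <= p%:R * `|1 - w ^+ k| ->
    4 / (p%:R * `|1 - w ^+ k|) <= (2 * m%:R^-1)%:C.
  move=> m0 le_m; have m20 : 0 < (2 * m)%:R :> R[i] by rewrite ltr0n muln_gt0.
  rewrite ler_pdivrMr ?(lt_le_trans m20)//.
  have -> : 4 = (2 * m%:R^-1)%:C * (2 * m)%:R :> R[i].
    rewrite -[X in _ * X](rmorph_nat (real_complex R)) -rmorphM natrM /=.
    rewrite mulrACA mulVf ?pnatr_eq0 -?lt0n// mulr1 -natrM.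
    by rewrite (rmorph_nat (real_complex R)).
  by rewrite ler_wpM2l// ler0c mulr_ge0// invr_ge0.
have [k2|k2] := leqP (2 * k) p.
  apply: le_trans (E k k0 _) _; first exact: chord_lower_bound_half.
  by rewrite lecR ler_wpM2l// lerDl invr_ge0.
apply: le_trans (E (p - k)%N _ _) _; first by rewrite subn_gt0.
  by rewrite -(norm_chordB (ltnW kp)) chord_lower_bound_half ?subn_gt0//; lia.
by rewrite lecR ler_wpM2l// lerDr invr_ge0.
Qed.

(** The lower bound on chords is positive; this is what makes [w] primitive. *)
Lemma unity_root_neq1 (k : nat) : (0 < k < p)%N -> w ^+ k != 1.
Proof.
move=> kp; apply/eqP => wk; have [k2|k2] := leqP (2 * k) p.
  have /andP[k0 _] := kp; have := chord_lower_bound_half k0 k2.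
  by rewrite wk subrr normr0 mulr0 lern0; lia.
have pk0 : (0 < p - k)%N by lia.
have /chord_lower_bound_half : (0 < p - k)%N by [].
rewrite norm_chordB ?wk; last by lia.
by rewrite subrr normr0 mulr0 lern0 => H; have := H ltac:(lia); lia.
Qed.

Lemma unity_root_prim : p.-primitive_root w.
Proof.
have [m w_m /dvdn_leq le_mp] := prim_order_exists p_gt0 unity_root_expr_order.
have mp := le_mp p_gt0; suff <- : m = p by [].
apply/eqP; rewrite eqn_leq mp leqNgt; apply/negP => ltmp.
have := @unity_root_neq1 m; rewrite ltmp (prim_order_gt0 w_m).
by rewrite (prim_expr_order w_m) eqxx => /(_ isT).
Qed.

End RootOfUnity.

(** * Harmonic sums and the half-period wave *)

(** Each new term [1 / x] is at most [ln x - ln (x - 1)], by [ln (1 + y) <= y] at [y = - 1 / x]. *)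
Lemma harmonic_sum_le (R : realType) (m : nat) : (0 < m)%N ->
  \sum_(1 <= k < m.+1) k%:R^-1 <= 1 + ln m%:R :> R.
Proof.
case: m => // m _; elim: m => [|m IHm].
  by rewrite big_nat1 invr1 ln1 addr0.
rewrite big_nat_recr//=; apply: le_trans (lerD IHm (lexx _)) _.
rewrite -addrA lerD2l; set x := m.+2%:R : R.
have x0 : 0 < x by rewrite ltr0n.
have m0 : 0 < m.+1%:R :> R by rewrite ltr0n.
have xE : x = m.+1%:R + 1 by rewrite /x -[m.+2]addn1 natrD.
have ratio : 1 + - x^-1 = m.+1%:R / x.
  apply: (mulIf (lt0r_neq0 x0)).
  by rewrite mulrDl mulNr mulVf ?divfK ?lt0r_neq0// xE; ring.
have lt1 : -1 < - x^-1 by rewrite -subr_gt0 opprK addrC ratio divr_gt0.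
have := le_ln1Dx lt1.
by rewrite ratio ln_div ?posrE// lerBlDr [- _ + _]addrC lerBrDr.
Qed.

Section SquareWave.
Variables (R : realType) (p : nat).
Hypothesis p_pr : prime p.
Local Open Scope complex_scope.

Let p_gt0 : (0 < p)%N := prime_gt0 p_pr.
Let w : R[i] := unity_root R p.
Let w_prim : p.-primitive_root w := unity_root_prim R p_gt0.
(** Half of [p] rounded up, so that [j < h] exactly when [2 * j < p]. *)
Let h := p.+1./2.
Local Notation f := (square_wave R[i] h).

Let hp : (h <= p)%N.
Proof. by rewrite /h; have := odd_double_half p.+1; lia. Qed.

(** The numbers of positive and negative values differ by the parity of [p], hence by at most 1. *)
Lemma fourier_coef_half_wave0 : `|fourier_coef p w f 0| <= p%:R^-1.
Proof.
rewrite (fourier_coef_square_wave0 _ hp) normrM normfV normr_nat.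
rewrite -[leRHS]mul1r ler_wpM2r ?invr_ge0//.
have -> : h%:R - (p - h)%:R = (odd p)%:R :> R[i].
  have := odd_double_half p.+1; rewrite -/h /= => e.
  rewrite -[h in h%:R](@subnK (p - h)); last by lia.
  by rewrite natrD addrK; congr _%:R; case: (odd p) e => /=; lia.
by rewrite normr_nat lern1 leq_b1.
Qed.

(** Frequency 0 costs at most 1. The others cost twice the sum of two harmonic sums, equal under
    [k -> p - k], hence at most [4 * (1 + ln p)]. *)
Lemma wiener_norm_half_wave :
  wiener_norm p w f <= (5 + 4 * ln p%:R)%:C.
Proof.
rewrite /wiener_norm -(big_mkord predT (fun k => `|fourier_coef p w f k|)).
rewrite (big_ltn p_gt0).
have -> : 5 + 4 * ln p%:R = 1 + 4 * (1 + ln p%:R) :> R by ring.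
rewrite rmorphD /= lerD//.
  apply: le_trans fourier_coef_half_wave0 _.
  by rewrite rmorph1 invf_le1 ?ltr0n// ler1n.
have le_k k : (0 < k < p)%N ->
    `|fourier_coef p w f k| <= (2 * (k%:R^-1 + (p - k)%:R^-1))%:C.
  move=> kp; apply: le_trans (inv_chord_le R p_gt0 kp).
  by apply: fourier_coef_square_wave => //; apply: unity_root_neq1.
rewrite big_nat.
apply: le_trans (ler_sum _ (fun k kp => le_k k kp)) _.
rewrite -big_nat -rmorph_sum lecR -mulr_sumr big_split /=.
have p_gt1 := prime_gt1 p_pr.
have rev : \sum_(1 <= k < p) (p - k)%:R^-1 = \sum_(1 <= k < p) k%:R^-1 :> R.
  rewrite big_nat_rev /= !big_nat; apply: eq_bigr => k /andP[k0 kp].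
  by congr (_%:R^-1); lia.
have H : \sum_(1 <= k < p) k%:R^-1 <= 1 + ln p%:R :> R.
  apply: le_trans (harmonic_sum_le R p_gt0).
  by rewrite big_nat_recr//= lerDl invr_ge0.
by rewrite rev; lra.
Qed.

(** As [#|X| <= p], the frequency 0 term adds at most 1 to the Wiener norm, which turns 5 into 6.
    The sum is real but is bounded through its image in [R[i]]. *)
Lemma half_wave_second_moment (X : {set 'I_p}) :
  \sum_(a < p) (\sum_(x in X) square_wave R h ((a * x) %% p)%N) ^+ 2 <=
  (6 + 4 * ln p%:R) ^+ 2 * (p%:R * #|X|%:R).
Proof.
pose S a := \sum_(x in X) square_wave R h ((a * x) %% p)%N; set L := ln p%:R.
have L0 : 0 <= L by rewrite ln_ge0// ler1n.
have SE (a : nat) : ((S a) ^+ 2)%:C =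
    `|\sum_(x in X) f ((a * x) %% p)%N| ^+ 2.
  have -> : \sum_(x in X) f ((a * x) %% p)%N = (S a)%:C.
    rewrite /S rmorph_sum; apply: eq_bigr => x _; rewrite /square_wave.
    by case: ifP => _; rewrite ?rmorphN rmorph1.
  rewrite normc_def /= expr0n addr0 sqrtr_sqr.
  by rewrite -rmorphXn real_normK// num_real.
rewrite -lecR rmorph_sum /=.
under eq_bigr => a _ do rewrite -/(S a) SE.
apply: le_trans (dilate_sum_second_moment w_prim _ _ p_pr) _.
have A0 : 0 <= wiener_norm p w f by apply: sumr_ge0.
have c0 : `|fourier_coef p w f 0| * #|X|%:R <= 1.
  apply: le_trans (ler_wpM2r _ fourier_coef_half_wave0) _ => //.
  rewrite mulrC ler_pdivrMr ?ltr0n// mul1r ler_nat.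
  by rewrite -[leqRHS]card_ord max_card.
have pX : (p%:R * #|X|%:R)%:C = p%:R * #|X|%:R :> R[i].
  by rewrite rmorphM !rmorph_nat.
have pX0 : 0 <= p%:R * #|X|%:R :> R[i] by rewrite mulr_ge0.
rewrite mulrCA [leRHS]rmorphM /= pX mulrC ler_wpM2r// rmorphXn /= expr2.
have B : wiener_norm p w f <= (6 + 4 * L)%:C.
  by apply: le_trans wiener_norm_half_wave _; rewrite lecR -/L; lra.
apply: ler_pM => //; first by rewrite addr_ge0// mulr_ge0.
have -> : (6 + 4 * L)%:C = 1 + (5 + 4 * L)%:C.
  by rewrite -(rmorph1 (real_complex R)) -rmorphD /=; congr (_ %:C); ring.
by rewrite lerD// wiener_norm_half_wave.
Qed.

End SquareWave.

(** * From bins to the wave, and the expected maxload *)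

Lemma bin2LH_half (p a x : nat) : (0 < p)%N ->
  bin2LH p a x = if ((a * x) %% p < p.+1./2)%N then 0 else 1.
Proof.
move=> p0; rewrite /bin2LH; set m := ((a * x) %% p)%N.
have mp : (m < p)%N by rewrite ltn_pmod.
have mpR : m.+1%:R <= p%:R :> rat by rewrite ler_nat.
have p0R : 0 < p%:R / 2 :> rat by rewrite divr_gt0// ltr0n.
have half_lt : (m < p.+1./2)%N = (m.*2 < p)%N.
  by have := odd_double_half p.+1; lia.
rewrite half_lt; case: ltnP => [lt_mp|le_pm]; apply: floor_def.
  rewrite add0r mulr1z mulr0z (divr_ge0 (ler0n _ _) (ltW p0R))/= ltr_pdivrMr//.
  have : m.*2.+1%:R <= p%:R :> rat by rewrite ler_nat.
  by rewrite -addn1 -mul2n natrD natrM; lra.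
rewrite intrD mulr1z ler_pdivlMr// ltr_pdivrMr//.
have : p%:R <= m.*2%:R :> rat by rewrite ler_nat.
by move: mpR; rewrite -addn1 -mul2n natrD natrM; lra.
Qed.

(** The maximum of [u] and [v] is [(u + v + |u - v|) / 2]; here the loads sum to [#|X|] and differ
    by the signed sum. *)
Lemma maxload2LHE (R : realType) (p : nat) (X : {set 'I_p}) (a : nat) :
  (0 < p)%N ->
  (maxload2LH X a)%:R = (#|X|%:R +
    `|\sum_(x in X) square_wave R p.+1./2 ((a * x) %% p)%N|) / 2 :> R.
Proof.
move=> p0; set P := fun x : 'I_p => ((a * x) %% p < p.+1./2)%N.
have l0 : load2LH X a 0 = (\sum_(x in X) P x)%N.
  rewrite /load2LH -sum1dep_card big_mkcondr; apply: eq_bigr => x _.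
  by rewrite bin2LH_half// /P; case: (_ < _)%N.
have l1 : load2LH X a 1 = (\sum_(x in X) ~~ P x)%N.
  rewrite /load2LH -sum1dep_card big_mkcondr; apply: eq_bigr => x _.
  by rewrite bin2LH_half// /P; case: (_ < _)%N.
have card : #|X|%:R = (load2LH X a 0)%:R + (load2LH X a 1)%:R :> R.
  rewrite l0 l1 -natrD -big_split -sum1_card; congr _%:R.
  by apply: eq_bigr => x _ /=; case: (P x).
have diff : \sum_(x in X) square_wave R p.+1./2 ((a * x) %% p)%N =
    (load2LH X a 0)%:R - (load2LH X a 1)%:R.
  rewrite l0 l1 !natr_sum -sumrB; apply: eq_bigr => x _.
  by rewrite /square_wave -/(P x); case: (P x); rewrite ?subr0 ?sub0r.
rewrite card diff /maxload2LH.
case: leqP => [le01|/ltnW le10].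
  rewrite ler0_norm ?subr_le0 ?ler_nat//; lra.
rewrite ger0_norm ?subr_ge0 ?ler_nat//; lra.
Qed.

Lemma expected_maxload2LH_le (R : realType) (p : nat) (X : {set 'I_p}) :
  prime p ->
  expected_maxload2LH R X <=
    #|X|%:R / 2 + Num.sqrt #|X|%:R * (6 + 4 * ln p%:R).
Proof.
move=> p_pr; have p_gt0 := prime_gt0 p_pr; have p_gt1 := prime_gt1 p_pr.
set S := fun a : nat =>
  \sum_(x in X) square_wave R p.+1./2 ((a * x) %% p)%N.
set n := #|X|%:R : R; set L := ln p%:R : R.
have L0 : 0 <= L by rewrite ln_ge0// ler1n.
set q := p.-1%:R : R.
have q0 : 0 < q by rewrite ltr0n; lia.
have pE : p%:R = q + 1 :> R by rewrite /q natr1; congr _%:R; rewrite prednK.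
have q1 : 1 <= q by rewrite ler1n; lia.
have n0 : 0 <= n by [].
set T : R := \sum_(1 <= a < p) `|S a|.
have T0 : 0 <= T by apply: sumr_ge0.
(* The 0/1 weight removes the multiplier 0, while the second moment, taken over all of Z/p, still
   bounds the weighted squares. *)
have TE : T = \sum_(a < p) (0 < a)%N%:R * `|S a|.
  rewrite -(big_mkord predT (fun a => (0 < a)%N%:R * `|S a|)).
  rewrite (big_ltn p_gt0) mul0r add0r /T !big_nat.
  by apply: eq_bigr => a /andP[-> _]; rewrite mul1r.
have WE : \sum_(a < p) (0 < a)%N%:R = q.
  rewrite -(big_mkord predT (fun a => (0 < a)%N%:R)) (big_ltn p_gt0) add0r.
  rewrite big_nat (eq_bigr (fun=> 1)); last by move=> a /andP[-> _].
  by rewrite -big_nat sumr_const_nat subn1.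
have T2 : T ^+ 2 <= q * ((6 + 4 * L) ^+ 2 * (p%:R * n)).
  rewrite TE; apply: le_trans (weighted_cauchy_schwarz _ _) _ => //.
  rewrite WE ler_wpM2l ?(ltW q0)//;
  apply: le_trans _ (half_wave_second_moment R p_pr X).
  apply: ler_sum => a _; rewrite real_normK ?num_real//.
  by case: (0 < a)%N; rewrite ?mul1r// mul0r sqr_ge0.
(* The factor 2 absorbs [p = q + 1] through [q * (q + 1) <= 4 * q ^+ 2], and later cancels the half
   in the maxload formula. *)
have Tle : T <= 2 * q * (Num.sqrt n * (6 + 4 * L)).
  rewrite -(@ler_pXn2r _ 2)// ?nnegrE//.
    apply: le_trans T2 _; rewrite !exprMn sqr_sqrtr// pE.
    set B := (6 + 4 * L) ^+ 2.
    have B0 : 0 <= B * n by rewrite mulr_ge0 ?sqr_ge0.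
    have -> : q * (B * ((q + 1) * n)) = (B * n) * (q * (q + 1)) by ring.
    have -> : 2 ^+ 2 * q ^+ 2 * (n * B) = (B * n) * (4 * q ^+ 2) by ring.
    by rewrite ler_wpM2l//; nra.
  by rewrite !mulr_ge0 ?sqrtr_ge0 ?ltW//; lra.
rewrite /expected_maxload2LH ler_pdivrMr//.
under eq_bigr do rewrite maxload2LHE//.
rewrite -mulr_suml big_split /= -/T sumr_const_nat subn1 -[_ *+ _]mulr_natr.
by rewrite -/q -/n; lra.
Qed.

Theorem mainTheorem5 (R : realType) (C : R) :
  exists k n0 : nat, forall n p : nat,
    (0 < n)%N -> (n0 <= n)%N -> prime p ->
    (n ^ 6 <= p)%N -> p%:R <= n%:R `^ C ->
    forall X : {set 'I_p}, #|X| = n ->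
      expected_maxload2LH R X
        <= n%:R / 2 + Num.sqrt n%:R * ln n%:R ^+ k.
Proof.
(* With [L = ln n], the threshold forces [L >= 6 + 4 * |C|], so [6 + 4 * ln p <= (6 + 4 * |C|) * L
   <= L ^+ 2]: the exponent 2 absorbs the constant. *)
exists 2, (Num.bound (expR (6 + 4 * `|C|))) => n p n_gt0 le_n p_pr _ pC X Xn.
apply: le_trans (expected_maxload2LH_le R X p_pr) _.
rewrite Xn lerD2l ler_wpM2l ?sqrtr_ge0//.
have n0 : 0 < n%:R :> R by rewrite ltr0n.
have lnp : ln p%:R <= C * ln n%:R :> R.
  by rewrite -ln_powR ler_ln// posrE ?powR_gt0// ltr0n prime_gt0.
have Cn : C <= `|C| by apply: ler_norm.
have C0 : 0 <= `|C| by [].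
have L_large : 6 + 4 * `|C| <= ln n%:R.
  rewrite -[leLHS]expRK ler_ln ?posrE ?expR_gt0//.
  apply: le_trans (ltW (archi_boundP (expR_ge0 _))) _.
  by rewrite ler_nat.
move: L_large lnp; set L := ln n%:R => L_large lnp.
by nra.
Qed.
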